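(* Let $d\ge1$ and let $\alpha\in\mathbb{R}^d$ be an irrational vector. If $S \subset \mathbb{R}^d$ is a Riemann measurable bounded remainder set (with respect to $\alpha$), then $S$ has a Riemann integrable transfer function.
   Context: A vector $\alpha = (\alpha_1,\dots,\alpha_d) \in \mathbb{R}^d$ is called irrational if $1, \alpha_1, \ldots, \alpha_d$ are linearly independent over $\mathbb{Q}$. We write $\mathbb{T}^d = \mathbb{R}^d/\mathbb{Z}^d$. For a bounded measurable set $S \subset \mathbb{R}^d$ let $\chi_S(x) = \sum_{k \in \mathbb{Z}^d} \mathbf{1}_S(x+k)$, a $\mathbb{Z}^d$-periodic function regarded as a function on $\mathbb{T}^d$. A bounded measurable set $S \subset \mathbb{R}^d$ is a bounded remainder set (BRS) with respect to $\alpha$ if there is a constant $C = C(S,\alpha)$ such that for every $n \geq 1$ and almost every $x \in \mathbb{T}^d$, $\left| \sum_{k=0}^{n-1} \chi_S(x+k\alpha) - n \operatorname{mes} S \right| \leq C$, where $\operatorname{mes}$ is Lebesgue measure. A bounded set in $\mathbb{R}^d$ is Riemann measurable if its boundary has Lebesgue measure zero. A transfer function for $S$ is a measurable function $g:\mathbb{T}^d\to\mathbb{R}$ satisfying $\chi_S(x) - \operatorname{mes} S = g(x) - g(x-\alpha)$ for a.e. $x \in \mathbb{T}^d$. Riemann integrable functions on $\mathbb{T}^d$ are the bounded functions that are continuous at almost every point. *)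

(* Defs.v *)
From HB Require Import structures.
From mathcomp Require Import all_boot all_order all_algebra.
From mathcomp Require Import all_classical all_reals all_analysis.

Set Implicit Arguments.
Unset Strict Implicit.
Unset Printing Implicit Defensive.

Import Order.TTheory GRing.Theory Num.Theory.
Import numFieldNormedType.Exports.

Local Open Scope classical_set_scope.
Local Open Scope ring_scope.

(** R^d is ['rV[R]_d] with d written [n.+1]: the outer measure below needs
    empty boxes, which do not exist in dimension 0. *)

Section box.
Context {R : realType} {n : nat}.
Implicit Types p : 'rV[R]_n.+1 * 'rV[R]_n.+1.

Definition box p : set 'rV[R]_n.+1 :=
  [set x | forall i, p.1 0 i < x 0 i <= p.2 0 i].

(** A box with [p.2 0 i <= p.1 0 i] for some i is empty and has volume 0. *)
Definition box_volume p : R := \prod_i Num.max 0 (p.2 0 i - p.1 0 i).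

Lemma box_volume_ge0 p : 0 <= box_volume p.
Proof. by apply: prodr_ge0 => i _; rewrite le_max lexx. Qed.

End box.

Section lebesgue_outer.
Context {R : realType} {n : nat}.
Local Notation V := 'rV[R]_n.+1.
Local Open Scope ereal_scope.

Definition box_cover (A : set V) : set (V * V)^nat :=
  [set p | A `<=` \bigcup_k box (p k)].

Definition lebesgue_outer (A : set V) : \bar R :=
  ereal_inf [set \sum_(k <oo) (box_volume (p k))%:E | p in box_cover A].

Let vol_ge0 (p : V * V) : 0 <= (box_volume p)%:E.
Proof. by rewrite lee_fin box_volume_ge0. Qed.

Let lebesgue_outer_ge0 A : 0 <= lebesgue_outer A.
Proof. by apply: le_ereal_inf_tmp => _ [p _ <-]; exact: nneseries_ge0. Qed.

Let lebesgue_outer0 : lebesgue_outer set0 = 0.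
Proof.
apply/eqP; rewrite eq_le lebesgue_outer_ge0 andbT.
apply: ereal_inf_lbound; exists (fun=> (0, 0)%R); first by [].
apply: eseries0 => k _ _; rewrite /box_volume big_ord_recl/= !mxE subrr.
by rewrite maxxx mul0r.
Qed.

Let le_lebesgue_outer : {homo lebesgue_outer : A B / A `<=` B >-> A <= B}.
Proof.
move=> A B AB; apply/ereal_inf_le_tmp => _ [p Bp <-].
by exists p => //; exact: subset_trans Bp.
Qed.

Let lebesgue_outer_sigma_subadditive : sigma_subadditive lebesgue_outer.
Proof.
move=> A; have [[i ioo]|] := pselect (exists i, lebesgue_outer (A i) = +oo).
  rewrite (eseries_pinfty _ _ ioo) ?leey// => m _.
  by rewrite -ltNye (lt_le_trans _ (lebesgue_outer_ge0 _)).
rewrite -forallNE => Aoo.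
suff add2e (e : {posnum R}) : lebesgue_outer (\bigcup_m A m) <=
    \sum_(i <oo) lebesgue_outer (A i) + e%:num%:E.
  by apply/lee_addgt0Pr => _/posnumP[].
rewrite (le_trans _ (epsilon_trick _ _ _))//.
pose P m (p : (V * V)^nat) := box_cover (A m) p /\
  \sum_(k <oo) (box_volume (p k))%:E <=
  lebesgue_outer (A m) + (e%:num / (2 ^ m.+1)%:R)%:E.
have [G PG] : {G : ((V * V)^nat)^nat & forall m, P m (G m)}.
  apply: (@choice _ _ P) => m; rewrite /P.
  have en1 : (0 < e%:num / (2 ^ m.+1)%:R)%R by [].
  have Afin : lebesgue_outer (A m) \is a fin_num.
    by rewrite ge0_fin_numE// ltey; apply/eqP; exact: Aoo.
  have [_ [p Ap <-] /ltW pS] := lb_ereal_inf_adherent en1 Afin.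
  by exists p.
pose v (ij : nat * nat) := (box_volume (G ij.1 ij.2))%:E.
have v_ge0 x : 0 <= v x by exact: vol_ge0.
apply: (@le_trans _ _ (\esum_(i in setT) v i)).
  apply: ereal_inf_lbound => /=.
  have /card_esym/ppcard_eqP[f] := card_nat2.
  exists (fun k => G (f k).1 (f k).2).
    move=> t [i _] /(PG i).1[j _ ?].
    by exists (f^-1%FUN (i, j)) => //=; rewrite invK ?inE.
  rewrite -(esum_pred_image v f xpredT) ?[fun=> _]set_true//.
  by rewrite image_eq.
rewrite (_ : esum _ _ = \sum_(i <oo) \sum_(j <oo) v (i, j)); last first.
  pose J : nat -> set (nat * nat) := fun i => [set (i, j) | j in setT].
  rewrite (_ : setT = \bigcup_k J k); last first.
    by rewrite predeqE => -[a b]; split => // _; exists a => //; exists b.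
  rewrite esum_bigcupT /=; last 2 first.
    - apply/trivIsetP => i j _ _ ij.
      rewrite predeqE => -[a b] /=; split => //= -[] [_] _ [<-{a} _].
      by move=> [m' _] [] /esym/eqP; rewrite (negbTE ij).
    - by move=> ij; exact: v_ge0.
  rewrite -(image_id [set: nat]) -fun_true esum_pred_image//; last first.
    by move=> i _; exact: esum_ge0.
  apply: eq_eseriesr => /= j _.
  rewrite -(esum_pred_image v (pair j) predT)//=; last first.
    by move=> ? ? _ _; exact: (@can_inj _ _ _ snd).
  by congr esum; rewrite predeqE => -[a b]; split; move=> [i _ <-]; exists i.
apply: lee_nneseries => i _; last exact: (PG i).2.
by move=> _; exact: nneseries_ge0.
Qed.

HB.instance Definition _ := isOuterMeasure.Build R V lebesgue_outer
  lebesgue_outer0 lebesgue_outer_ge0 le_lebesgue_outer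
  lebesgue_outer_sigma_subadditive.

End lebesgue_outer.

(** R^(n+1) with the sigma-algebra of Lebesgue (Caratheodory) measurable sets. *)
Notation leb_space R n := (caratheodory_type (@lebesgue_outer R n)).

Definition mes {R : realType} {n : nat} : set (leb_space R n) -> \bar R :=
  @lebesgue_outer R n.
HB.instance Definition _ (R : realType) (n : nat) :=
  isMeasure.Build _ _ R (@mes R n)
    (@caratheodory_measure0 R _ (@lebesgue_outer R n))
    (@caratheodory_measure_ge0 R _ (@lebesgue_outer R n))
    (@caratheodory_measure_sigma_additive R _ (@lebesgue_outer R n)).

Section bounded_remainder_sets.
Context {R : realType} {n : nat}.
Local Notation V := 'rV[R]_n.+1.
Implicit Types (S : set V) (alpha x : V) (g : V -> R).

Definition lebesgue_measurable S := measurable (S : set (leb_space R n)).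

Definition irrational_vector alpha :=
  forall (q0 : rat) (q : 'rV[rat]_n.+1),
    ratr q0 + \sum_i ratr (q 0 i) * alpha 0 i = 0 -> q0 = 0 /\ q = 0.

Definition of_intvec (k : 'rV[int]_n.+1) : V := map_mx intr k.

(** A function on the torus is a Z^d-periodic function on R^d. A set of points
    of the torus is null iff its preimage in R^d is null, and a function on the
    torus is measurable, bounded, or continuous at a point, iff its periodic
    lift is. *)
Definition torus_function g := forall k, periodic g (of_intvec k).

(** Finitely supported sum: for bounded S only finitely many terms are
    nonzero. *)
Definition chi S x : R :=
  \sum_(k \in [set: 'rV[int]_n.+1]) (\1_S (x + of_intvec k) : R).

Definition bounded_remainder_set alpha S :=
  [/\ bounded_set S, lebesgue_measurable S &
    exists C : R, forall m : nat, (1 <= m)%N ->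
      \forall x \ae mes,
        `| \sum_(0 <= k < m) chi S (x + alpha *+ k) - m%:R * fine (mes S) |
          <= C].

Definition boundary S : set V := closure S `\` S^°.

Definition riemann_measurable S := bounded_set S /\ mes (boundary S) = 0%E.

Definition transfer_function alpha S g :=
  [/\ torus_function g,
      measurable_fun [set: leb_space R n] (g : leb_space R n -> R) &
      \forall x \ae mes, chi S x - fine (mes S) = g x - g (x - alpha)].

Definition riemann_integrable_torus g :=
  [/\ torus_function g, bounded_fun g &
      \forall x \ae mes, {for (x : V), continuous g}].

End bounded_remainder_sets.

(* Main.v *)
Require Import Defs.
From mathcomp Require Import all_boot all_order all_algebra.
From mathcomp Require Import all_classical all_reals all_analysis.
From mathcomp Require Import measurable_realfun ring lra.

Set Implicit Arguments.
Unset Strict Implicit.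
Unset Printing Implicit Defensive.

Import Order.TTheory GRing.Theory Num.Theory.
Import numFieldNormedType.Exports.

Local Open Scope classical_set_scope.
Local Open Scope ring_scope.

(** Let f be chi S minus the measure of S, and let G be the set of points
    none of whose translates by alpha *~ z + p, with z an integer and p an
    integer vector, lies on the boundary of S. The complement of G is a
    countable union of translates of a null set, so G has full measure and
    in particular is dense (ae_dense). It is invariant under translation by
    alpha and by integer vectors, and f is locally constant at each of its
    points (chi_locally_constant). Consequently the bound on the sums of f
    along orbits, known almost everywhere, holds at every point of G
    (off_boundary_orbit_sum_bound).

    The rest is an argument of Gottschalk and Hedlund carried out on G
    (continuous_coboundary_on). At x in G, take the supremum and the infimum
    over all integers z of the sums of f along the orbit of x up to time z.
    Both satisfy the same cohomological equation, so their difference is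
    invariant under the rotation. The sums are continuous at the points of
    G, so their supremum is lower semicontinuous there and their infimum
    upper semicontinuous; the difference is lower semicontinuous, so, being
    invariant along dense orbits, it is constant on G. Hence the supremum is
    also upper semicontinuous on G. Being continuous on a dense set and
    bounded, it extends to a bounded periodic function on the whole space
    which is continuous at every point of G, and the opposite of this
    extension is the transfer function. Its measurability follows from its
    continuity almost everywhere (ae_continuous_measurable).

    Density of orbits is Kronecker's theorem (kronecker), proved by
    averaging a product of Fejer kernels along the orbit. Density of sets of
    full measure rests on the fact that a box has outer measure at least its
    volume (box_outer_ge). *)

(** * Averages along sequences and the Fejer kernel *)

Section bounded_deviation.
Context {R : realType}.
Implicit Types (u v : nat -> R) (mu nu : R).

(** Bounded deviation is stronger than convergence of the averages, and
    unlike it is preserved by finite linear combinations without any limit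
    argument. *)
Definition has_mean u mu :=
  exists B, forall M, `|\sum_(k < M) u k - M%:R * mu| <= B.

Lemma has_mean_cst mu : has_mean (fun=> mu) mu.
Proof.
exists 0 => M; by rewrite sumr_const card_ord mulr_natl subrr normr0.
Qed.

Lemma has_meanD u v mu nu :
  has_mean u mu -> has_mean v nu -> has_mean (fun k => u k + v k) (mu + nu).
Proof.
move=> [B HB] [B' HB']; exists (B + B') => M.
rewrite big_split /= mulrDr opprD addrACA.
exact: le_trans (ler_normD _ _) (lerD (HB M) (HB' M)).
Qed.

Lemma has_meanZ a u mu : has_mean u mu -> has_mean (fun k => a * u k) (a * mu).
Proof.
move=> [B HB]; exists (`|a| * B) => M.
rewrite -mulr_sumr mulrCA -mulrBr normrM; exact: ler_wpM2l (HB M).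
Qed.

Lemma has_mean_sum (I : Type) (r : seq I) (u : I -> nat -> R) (mu : I -> R) :
  (forall i, has_mean (u i) (mu i)) ->
  has_mean (fun k => \sum_(i <- r) u i k) (\sum_(i <- r) mu i).
Proof.
move=> umu; elim: r => [|i r IH].
  rewrite big_nil; have -> : (fun k => \sum_(i <- [::]) u i k) = fun=> 0.
    by apply/funext => k; rewrite big_nil.
  exact: has_mean_cst.
rewrite big_cons; have -> : (fun k => \sum_(j <- i :: r) u j k) =
    fun k => u i k + \sum_(j <- r) u j k.
  by apply/funext => k; rewrite big_cons.
exact: has_meanD.
Qed.

Lemma has_mean_le u v mu nu :
  (forall k, u k <= v k) -> has_mean u mu -> has_mean v nu -> mu <= nu.
Proof.
move=> uv [B HB] [B' HB']; rewrite leNgt; apply/negP => nulmu.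
have d0 : 0 < mu - nu by rewrite subr_gt0.
have [M] : exists M : nat, (B + B') / (mu - nu) < M%:R.
  exists (Num.bound `|(B + B') / (mu - nu)|).
  by rewrite (le_lt_trans (ler_norm _))// archi_boundP.
rewrite ltr_pdivrMr// ltNge => /negP; apply.
have := HB M; have := HB' M; rewrite !ler_norml => /andP[_ b] /andP[a _].
have : \sum_(k < M) u k <= \sum_(k < M) v k by apply: ler_sum => k _; exact: uv.
rewrite mulrBr; lra.
Qed.

End bounded_deviation.

Section fejer.
Context {R : realType}.
Implicit Types (N : nat) (y c : R).

(** Multiplying by 2 sin (y / 2) turns each cosine into a difference of two
    consecutive sines, so the sum telescopes. *)
Lemma sum_cos_arith N y c :
  sin (y / 2) *+ 2 * \sum_(l < N) cos (l%:R * y + c) =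
  sin (N%:R * y + c - y / 2) - sin (c - y / 2).
Proof.
elim: N => [|N IH]; first by rewrite big_ord0 mulr0 mul0r add0r subrr.
rewrite big_ord_recr /= mulrDr IH; set A := N%:R * y + c.
have -> : N.+1%:R * y + c - y / 2 = A + y / 2 by rewrite /A -natr1; lra.
rewrite (sinB A) (sinD A); ring.
Qed.

Lemma norm_sum_cos_arith_le N y c : sin (y / 2) != 0 ->
  `|\sum_(l < N) cos (l%:R * y + c)| <= `|sin (y / 2)|^-1.
Proof.
move=> s0; have s0' : 0 < `|sin (y / 2)| by rewrite normr_gt0.
rewrite -(ler_pM2l s0') mulfV ?gt_eqF// -normrM.
have := sum_cos_arith N y c; rewrite (mulrnAl (sin _)) => /(congr1 Num.norm).
rewrite normrMn => E.
have : `|sin (y / 2) * \sum_(l < N) cos (l%:R * y + c)| *+ 2 <= 1 + 1.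
  by rewrite E (le_trans (ler_normB _ _))// lerD// sin_max.
lra.
Qed.

Lemma has_mean_cos y c : sin (y / 2) != 0 ->
  has_mean (fun k => cos (k%:R * y + c)) 0.
Proof.
move=> s0; exists `|sin (y / 2)|^-1 => M.
by rewrite mulr0 subr0 norm_sum_cos_arith_le.
Qed.

(** The Fejer kernel: the square of the modulus of the sum of the exp(i l
    y), l < N, hence N times the usual normalization. *)
Definition fejer N y : R :=
  \sum_(l < N) \sum_(m < N) cos ((l%:R - m%:R) * y).

Lemma fejerE N y : fejer N y =
  (\sum_(l < N) cos (l%:R * y)) ^+ 2 + (\sum_(l < N) sin (l%:R * y)) ^+ 2.
Proof.
rewrite !expr2 !mulr_suml -big_split /=; apply: eq_bigr => l _.
rewrite !mulr_sumr -big_split /=; apply: eq_bigr => m _.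
by rewrite mulrBl cosB.
Qed.

Lemma fejer_ge0 N y : 0 <= fejer N y.
Proof. by rewrite fejerE addr_ge0// sqr_ge0. Qed.

Lemma fejer_le N y : sin (y / 2) != 0 -> fejer N y <= 2 / sin (y / 2) ^+ 2.
Proof.
move=> s0; rewrite fejerE.
have sq (x : R) : `|x| <= `|sin (y / 2)|^-1 -> x ^+ 2 <= (sin (y / 2) ^+ 2)^-1.
  move=> h; rewrite -(real_normK (num_real x)).
  by rewrite -(real_normK (num_real (sin _))) -exprVn lerXn2r ?nnegrE ?invr_ge0.
rewrite mulrDl mul1r lerD//; apply: sq.
  under eq_bigr do rewrite -[_ * y]addr0.
  exact: norm_sum_cos_arith_le.
under eq_bigr do rewrite -cosBpihalf.
exact: norm_sum_cos_arith_le.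
Qed.

(** The kernel is even in y, so the sine part of the addition formula
    cancels between (l, m) and (m, l). This expands a product of kernels one
    factor at a time, with a single cosine left in each term. *)
Lemma cosM_fejer N y c : cos c * fejer N y =
  \sum_(l < N) \sum_(m < N) cos (c + (l%:R - m%:R) * y).
Proof.
have odd0 : \sum_(l < N) \sum_(m < N) sin ((l%:R - m%:R) * y) = 0.
  under eq_bigr do under eq_bigr do rewrite mulrBl sinB.
  under eq_bigr do rewrite sumrB.
  rewrite sumrB [X in _ - X]exchange_big /=.
  by under [X in _ - X]eq_bigr do under eq_bigr do rewrite mulrC; rewrite subrr.
under [RHS]eq_bigr do under eq_bigr do rewrite cosD.
under [RHS]eq_bigr do rewrite sumrB.
rewrite sumrB.
under [X in _ - X]eq_bigr do rewrite -mulr_sumr.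
rewrite -mulr_sumr odd0 mulr0 subr0 mulr_sumr.
by under eq_bigr do rewrite mulr_sumr.
Qed.

End fejer.

Section distance_to_integers.
Context {R : realType}.
Implicit Types (x d : R).

Lemma norm_sin_piDz x (p : int) : `|sin (pi * (x + p%:~R))| = `|sin (pi * x)|.
Proof.
have pn (m : nat) (z : R) : `|sin (pi * (z + m%:R))| = `|sin (pi * z)|.
  rewrite mulrDr mulr_natr.
  by rewrite (alternatingn (@sinDpi R)) normrM normrX normrN1 expr1n mul1r.
case: p => m; first exact: pn.
by rewrite -(pn m.+1) NegzE mulrNz subrK.
Qed.

(** The function |sin (pi x)| only depends on the distance from x to the
    integers and increases with it. *)
Lemma near_int_or_sin d x : 0 < d -> d <= 1 / 2 ->
  (exists p : int, `|x - p%:~R| < d) \/ sin (pi * d) <= `|sin (pi * x)|.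
Proof.
(* p is an integer nearest to x. *)
move=> d0 d2; pose p := Num.floor (x + 1 / 2); pose t := x - p%:~R.
have pi0 := pi_gt0 R.
have t2 : `|t| <= 1 / 2.
  have := floor_itv (x + 1 / 2); rewrite -/p intrD /= => /andP[a b].
  rewrite ler_norml /t; lra.
have [td|dt] := ltP `|t| d; [by left; exists p|right].
rewrite -(subrK p%:~R x) norm_sin_piDz -/t.
have -> : `|sin (pi * t)| = sin (pi * `|t|).
  have ge0 : 0 <= sin (pi * `|t|) by apply: sin_ge0_pi; nra.
  case: (ger0P t) ge0 => _ ge0; first by rewrite ger0_norm.
  by rewrite -[pi * t]opprK -mulrN sinN normrN ger0_norm.
rewrite leNgt ltr_sin -?leNgt; first by nra.
- by rewrite in_itv /=; nra.
- by rewrite in_itv /=; nra.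
Qed.

End distance_to_integers.

(** * Kronecker's theorem on inhomogeneous approximation *)

Section kronecker.
Context {R : realType} {n : nat}.
Variable alpha : 'rV[R]_n.+1.
Hypothesis irr : irrational_vector alpha.
Implicit Types (q : 'rV[int]_n.+1) (beta : 'rV[R]_n.+1).

Let dotz q : R := \sum_i (q 0 i)%:~R * alpha 0 i.

Let dotzD q q' : dotz (q + q') = dotz q + dotz q'.
Proof.
by rewrite -big_split /=; apply: eq_bigr => i _; rewrite mxE intrD mulrDl.
Qed.

Let dotz_delta z j : dotz (z *: delta_mx 0 j) = z%:~R * alpha 0 j.
Proof.
rewrite /dotz (bigD1 j)//= !mxE !eqxx mulr1 big1 ?addr0// => i /negPf ij.
by rewrite !mxE ij andbF mulr0 mul0r.
Qed.

Lemma irrational_dot_nonint q (p : int) :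
  \sum_i (q 0 i)%:~R * alpha 0 i = p%:~R -> q = 0.
Proof.
move=> qp; have [|_ /matrixP q0] := irr (q0 := - p%:~R) (q := map_mx intr q).
  rewrite rmorphN /= ratr_int -qp -[X in _ + X](_ : \sum_i (q 0 i)%:~R * alpha 0 i = _).
    by rewrite addNr.
  by apply: eq_bigr => i _; rewrite mxE ratr_int.
apply/matrixP => i j; have := q0 i j; rewrite !mxE => /eqP.
by rewrite intr_eq0 => /eqP.
Qed.

Let sin_dotz q : q != 0 -> sin (2 * pi * dotz q / 2) != 0.
Proof.
move=> q0; apply/negP => /eqP s0; case/negP: q0; apply/eqP.
have [p pE] : exists p : int, dotz q = p%:~R; last exact: irrational_dot_nonint pE.
pose p := Num.floor (dotz q); exists p.
have /andP[] := floor_itv (dotz q); rewrite -/p intrD => lep ltp.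
have := norm_sin_piDz (dotz q - p%:~R) p.
rewrite subrK (_ : pi * dotz q = 2 * pi * dotz q / 2); last by field.
rewrite s0 normr0 => /esym/eqP; rewrite normr_eq0 => /eqP s1.
apply/eqP; rewrite eq_le lep andbT leNgt; apply/negP => plt.
have := @sin_gt0_pi R (pi * (dotz q - p%:~R)); rewrite s1 ltxx => W.
have pi0 := pi_gt0 R.
by suff : false by []; apply: W; apply/andP; split; nra.
Qed.

(** Along the orbit, a product of kernels in distinct coordinates averages
    to the product of their integrals. Expanding the factor of index j
    shifts the frequency q by (l - m) e_j. A nonzero frequency averages to
    0, because irrationality makes q . alpha a non-integer; since q_j = 0,
    only the N diagonal terms l = m of a zero frequency survive. *)
Lemma has_mean_fejer_prod N beta (s : seq 'I_n.+1) q c :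
  uniq s -> (forall i, i \in s -> q 0 i = 0) ->
  has_mean (fun k => cos (k%:R * (2 * pi * dotz q) + c) *
      \prod_(j <- s) fejer N (2 * pi * (k%:R * alpha 0 j - beta 0 j)))
    (if q == 0 then cos c * N%:R ^+ size s else 0).
Proof.
elim: s q c => [|j s IH] q c /=.
  move=> _ _.
  rewrite [X in has_mean X _](_ : _ = fun k => cos (k%:R * (2 * pi * dotz q) + c)).
    case: eqVneq => [->|q0]; last exact/has_mean_cos/sin_dotz.
    rewrite expr0 mulr1 [X in has_mean X _](_ : _ = fun=> cos c).
      exact: has_mean_cst.
    apply/funext => k; rewrite /dotz big1 ?mulr0 ?add0r// => i _.
    by rewrite mxE mul0r.
  by apply/funext => k; rewrite big_nil mulr1.
case/andP=> js us qs.
pose u (l m : 'I_N) k := cos (k%:R *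
    (2 * pi * dotz (q + ((l : nat)%:Z - (m : nat)%:Z) *: delta_mx 0 j)) +
    (c - (l%:R - m%:R) * (2 * pi * beta 0 j))) *
  \prod_(j <- s) fejer N (2 * pi * (k%:R * alpha 0 j - beta 0 j)).
rewrite [X in has_mean X _](_ : _ = fun k => \sum_(l < N) \sum_(m < N) u l m k).
  rewrite [X in has_mean _ X](_ : _ = \sum_(l < N) \sum_(m < N)
    (if q + ((l : nat)%:Z - (m : nat)%:Z) *: delta_mx 0 j == 0
     then cos (c - (l%:R - m%:R) * (2 * pi * beta 0 j)) * N%:R ^+ size s else 0)).
    apply: has_mean_sum => l; apply: has_mean_sum => m.
    apply: IH => // i si; rewrite !mxE qs ?inE ?si ?orbT// add0r.
    by case: (eqVneq i j) si => [->|_ _]; [rewrite (negPf js)|rewrite mulr0].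
  have eq0 (l m : 'I_N) :
      (q + ((l : nat)%:Z - (m : nat)%:Z) *: delta_mx 0 j == 0) =
      (q == 0) && (l == m).
    apply/eqP/andP => [E|[/eqP-> /eqP->]]; last by rewrite subrr scale0r addr0.
    have /eqP : ((l : nat)%:Z - (m : nat)%:Z) = 0.
      have /matrixP/(_ 0 j) := E; rewrite !mxE qs ?inE ?eqxx// add0r /=.
      by rewrite mulr1.
    rewrite subr_eq0 => /eqP[lm]; split; last exact/eqP/val_inj.
    by move: E; rewrite lm subrr scale0r addr0 => ->.
  case: eqVneq => [q0|q0].
    transitivity (\sum_(l < N) cos c * N%:R ^+ size s).
      by rewrite sumr_const card_ord exprS mulrCA mulr_natl.
    apply: eq_bigr => l _; rewrite (bigD1 l)//= big1 => [|m /negPf ml].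
      by rewrite eq0 q0 !eqxx subrr mul0r subr0 addr0.
    by rewrite eq0 [l == m]eq_sym ml andbF.
  by rewrite big1// => l _; rewrite big1// => m _; rewrite eq0 (negPf q0).
apply/funext => k; rewrite big_cons mulrA cosM_fejer mulr_suml.
apply: eq_bigr => l _; rewrite mulr_suml; apply: eq_bigr => m _.
rewrite /u dotzD dotz_delta intrD rmorphN /=; congr (cos _ * _); ring.
Qed.

(** Kronecker's theorem. If every point of the orbit had a coordinate at
    distance at least d from beta modulo 1, the kernel of that coordinate
    would be at most a constant D independent of N. The product of all n + 1
    kernels would then be at most the sum over i of D times the product of
    the other kernels. Averaging along the orbit gives N ^ (n + 1) <= (n +
    1) D N ^ n, which fails for large N. *)
Theorem kronecker beta (d : R) : 0 < d ->
  exists (k : nat) (p : 'rV[int]_n.+1),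
    forall i, `|k%:R * alpha 0 i - beta 0 i - (p 0 i)%:~R| < d.
Proof.
wlog d2 : d / d <= 1 / 2 => [wh d0|d0].
  have [| |k [p kpd]] := wh (Num.min d (1 / 2)); first by rewrite ge_min lexx orbT.
    by rewrite lt_min d0 divr_gt0.
  exists k, p => i.
  by rewrite (lt_le_trans (kpd i))// ge_min lexx.
apply: contrapT => far.
have pi0 := pi_gt0 R.
pose sg := sin (pi * d); have sg0 : 0 < sg.
  by apply: sin_gt0_pi; apply/andP; split; nra.
pose y k i := k%:R * alpha 0 i - beta 0 i.
(* Otherwise the integers near the coordinates would form a vector p. *)
have {}far k : exists i, sg <= `|sin (pi * y k i)|.
  apply: contrapT => H; apply: far.
  have /choice[p pP] : forall i, exists p : int, `|y k i - p%:~R| < d.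
    move=> i; case: (near_int_or_sin (y k i) d0 d2) => // H'.
    by case: H; exists i.
  by exists k, (\row_i p i) => i; rewrite mxE; exact: pP.
pose D := 2 / sg ^+ 2; have D0 : 0 < D by rewrite divr_gt0// exprn_gt0.
pose N := (Num.bound (n.+1%:R * D)).
have NP : n.+1%:R * D < N%:R by rewrite archi_boundP// mulr_ge0// ltW.
have N0 : 0 < N%:R :> R by rewrite (le_lt_trans _ NP)// mulr_ge0// ltW.
have mean s : uniq s ->
    has_mean (fun k => \prod_(j <- s) fejer N (2 * pi * y k j)) (N%:R ^+ size s).
  move=> us; have := @has_mean_fejer_prod N beta s 0 0 us.
  rewrite eqxx cos0 mul1r => /(_ (fun i _ => mxE _ _ _ _)).
  congr has_mean; apply/funext => k; rewrite /dotz big1 ?mulr0 ?addr0 ?cos0 ?mul1r//.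
  by move=> i _; rewrite mxE mul0r.
have : N%:R ^+ n.+1 <= \sum_(i : 'I_n.+1) D * N%:R ^+ n :> R.
  have m1 := mean (index_enum 'I_n.+1) (index_enum_uniq _).
  have sz : size (index_enum 'I_n.+1) = n.+1.
    by rewrite -[RHS]card_ord cardT enumT.
  rewrite sz in m1; apply: has_mean_le m1 _; last first.
    apply: has_mean_sum => i; apply: has_meanZ.
    have := mean (rem i (index_enum 'I_n.+1)) (rem_uniq _ (index_enum_uniq _)).
    by rewrite size_rem ?mem_index_enum// sz; exact.
  move=> k /=; have [i iP] := far k; rewrite (bigD1 i)//=.
  have Fi : fejer N (2 * pi * y k i) <= D.
    have E : 2 * pi * y k i / 2 = pi * y k i by field.
    have s0 : sin (2 * pi * y k i / 2) != 0.
      by rewrite E -normr_gt0 (lt_le_trans sg0).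
    apply: le_trans (fejer_le N s0) _; rewrite E ler_pM2l//.
    rewrite -(real_normK (num_real (sin _))) lef_pV2 ?posrE ?exprn_gt0//.
      by rewrite lerXn2r// nnegrE ltW.
    exact: lt_le_trans iP.
  rewrite [leRHS](bigD1 i)//= -[leLHS]addr0 lerD//.
    rewrite -big_filter -rem_filter ?index_enum_uniq// ler_wpM2r// prodr_ge0 // => *.
    exact: fejer_ge0.
  apply: sumr_ge0 => j _; apply: mulr_ge0; first exact: ltW.
  by apply: prodr_ge0 => *; exact: fejer_ge0.
rewrite sumr_const card_ord exprS -mulrnAl ler_pM2r ?exprn_gt0//.
by move: NP; rewrite mulr_natl => NP; rewrite leNgt NP.
Qed.

End kronecker.

(** * Lebesgue outer measure of boxes and Lebesgue measurable sets *)

Section interval_covers.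
Context {R : realType}.

(** Integrating over one coordinate of a box: a lower bound that holds for
    each value of that coordinate in ]a, b] survives with the factor b - a,
    while each indicator of an interval becomes at most the length of the
    interval. *)
Lemma le_nneseries_itv (a b c : R) (C l u : nat -> R) :
  a < b -> 0 <= c -> (forall k, 0 <= C k) ->
  (forall t, a < t <= b ->
    (c%:E <= \sum_(k <oo) (C k * \1_(`]l k, u k]) t)%:E)%E) ->
  ((c * (b - a))%:E <= \sum_(k <oo) (C k * Num.max 0 (u k - l k))%:E)%E.
Proof.
move=> ab c0 C0 H; pose mu := @lebesgue_measure R.
have lm (x y : R) : mu `]x, y]%classic = (Num.max 0 (y - x))%:E.
  rewrite /mu lebesgue_measure_itv /= lte_fin; case: ltP => xy.
    by rewrite -EFinB max_r// subr_ge0 ltW.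
  by rewrite max_l// subr_le0.
have mI : measurable (`]a, b] : set R) by exact: measurable_itv.
have mf k : measurable_fun `]a, b] (fun t => (C k * \1_(`]l k, u k]) t)%:E).
  apply/measurable_EFinP; apply: measurable_funM => //.
have f0 k t : `]a, b]%classic t -> (0 <= (C k * \1_(`]l k, u k]) t)%:E)%E.
  by move=> _; rewrite lee_fin mulr_ge0.
have -> : (c * (b - a))%:E = (\int[mu]_(t in `]a, b]) cst c%:E t)%E.
  rewrite integral_cst// EFinM; congr (_ * _)%E.
  by rewrite -(max_r (ltW (_ : 0 < b - a))) ?subr_gt0//; exact/esym/lm.
apply: (@le_trans _ _
  (\int[mu]_(t in `]a, b]) \sum_(k <oo) (C k * \1_(`]l k, u k]) t)%:E)%E).
  apply: ge0_le_integral => //.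
  by apply: ge0_emeasurable_sum => k *; [exact: f0|exact: mf].
rewrite integral_nneseries//; apply: lee_nneseries => [k _ _|k _].
  by apply: integral_ge0 => t; exact: f0.
under eq_integral do rewrite EFinM.
rewrite ge0_integralZl_EFin//; last first.
  by apply/measurable_EFinP; exact: measurable_indic.
rewrite integral_indic// EFinM; apply: lee_wpmul2l; first by rewrite lee_fin.
apply: (@le_trans _ _ (mu `]l k, u k]%classic)); last by rewrite lm.
by apply: le_measure; rewrite ?inE//; exact: measurableI.
Qed.

End interval_covers.


Section lebesgue_outer_theory.
Context {R : realType} {n : nat}.
Local Notation V := 'rV[R]_n.+1.
Implicit Types (A U : set V) (a b x y v : V).

(** The sum of the indicators of the boxes of a cover is at least 1 on the
    covered box. Integrating this inequality one coordinate at a time, by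
    monotone convergence on the line, turns it into the comparison of
    volumes. *)
Lemma box_outer_ge a b : (forall i, a 0 i < b 0 i) ->
  ((\prod_i (b 0 i - a 0 i))%:E <= lebesgue_outer (box (a, b)))%E.
Proof.
move=> ab; apply: le_ereal_inf_tmp => _ [p pc <-].
pose len k (i : 'I_n.+1) : R := Num.max 0 ((p k).2 0 i - (p k).1 0 i).
have len0 k i : 0 <= len k i by rewrite le_max lexx.
pose T r k x (i : 'I_n.+1) : R := if (i < r)%N then len k i
  else \1_(`](p k).1 0 i, (p k).2 0 i]) (x 0 i).
have T0 r k x i : 0 <= T r k x i by rewrite /T; case: ifP.
(* In the factor T r k x i, the coordinates i < r have been integrated out. *)
have rec r : (r <= n.+1)%N -> forall x, box (a, b) x ->
    ((\prod_(i < n.+1 | (i < r)%N) (b 0 i - a 0 i))%:E <=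
     \sum_(k <oo) (\prod_i T r k x i)%:E)%E.
  elim: r => [_ x /pc[k _ kx]|r IH rn x abx].
    rewrite big_pred0//; apply: le_trans (nneseries_lim_ge k.+1 _); last first.
      by move=> *; rewrite lee_fin; exact: prodr_ge0.
    rewrite big_nat_recr//= -[leLHS]add0e leeD//.
      by apply: sume_ge0 => *; rewrite lee_fin; exact: prodr_ge0.
    rewrite lee_fin big1// => i _; rewrite /T /= indicE mem_set//=.
    by rewrite in_itv /=; exact: kx.
  pose j := Ordinal rn.
  rewrite (bigD1 j)/=; last exact: ltnSn.
  rewrite mulrC (eq_bigl (fun i : 'I_n.+1 => (i < r)%N)); last first.
    move=> i; rewrite -val_eqE/= ltnS; case: ltngtP => //.
  pose C k := \prod_(i | i != j) T r k x i.
  rewrite (eq_eseriesr (g := fun k => (C k * len k j)%:E)); last first.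
    move=> k _; rewrite (bigD1 j)//= mulrC; congr (_ * _)%:E; last first.
      by rewrite /T ltnSn.
    apply: eq_bigr => i; rewrite -val_eqE/= /T ltnS => ij.
    by rewrite leq_eqVlt (negPf ij).
  apply: le_nneseries_itv.
  - exact: ab.
  - by apply: prodr_ge0 => i _; rewrite subr_ge0 ltW.
  - by move=> k; exact: prodr_ge0.
  move=> t abt; pose xt : V := \row_i (if i == j then t else x 0 i).
  have /(IH (ltnW rn)) : box (a, b) xt.
    by move=> i; rewrite mxE; case: eqP => [->|_] //; exact: abx.
  congr (_ <= _)%E; apply: eq_eseriesr => k _; rewrite (bigD1 j)//= mulrC.
  congr (_ * _)%:E; last by rewrite /T ltnn mxE eqxx.
  by apply: eq_bigr => i /negPf ij; rewrite /T mxE ij.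
have := rec n.+1 (leqnn _) b; rewrite [X in (X%:E <= _)%E](eq_bigl xpredT); last first.
  by move=> i; rewrite /= ltn_ord.
have bb : box (a, b) b by move=> i; rewrite ab lexx.
move=> /(_ bb) /le_trans; apply; apply: lee_nneseries => [k _ _|k _].
  by rewrite lee_fin; exact: prodr_ge0.
by rewrite lee_fin; apply: ler_prod => i _; rewrite T0 /T ltn_ord /=.
Qed.

Lemma nbhs_box x U : nbhs x U ->
  exists2 e : R, 0 < e & forall y, (forall i, `|y 0 i - x 0 i| < e) -> U y.
Proof.
move=> /nbhs_ballP[e e0 eU]; exists e => // y xy; apply: eU.
split => // i j; rewrite ord1 /ball /= distrC; exact: xy.
Qed.

(** A nonempty open set contains a box, which is not null. *)
Lemma ae_dense (P : V -> Prop) x U :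
  (\forall y \ae mes, P y) -> nbhs x U -> exists2 y, U y & P y.
Proof.
move=> [N [_ N0 PN]] /nbhs_box[e e0 eU]; apply: contrapT => H.
pose a : V := \row_i (x 0 i - e / 2); pose b : V := \row_i (x 0 i + e / 2).
have abN : box (a, b) `<=` N.
  move=> y aby; apply: PN => Py; apply: H; exists y => //; apply: eU => i.
  have := aby i; rewrite !mxE ltr_norml => /andP[]; lra.
have ab i : a 0 i < b 0 i by rewrite !mxE; lra.
have : ((\prod_i (b 0 i - a 0 i))%:E <= 0 :> \bar R)%E.
  by rewrite -N0 (le_trans (box_outer_ge ab))//; exact: le_outer_measure.
rewrite lee_fin leNgt => /negP; apply; apply: prodr_gt0 => i _.
by rewrite subr_gt0.
Qed.

Lemma le_lebesgue_outer_shift v A :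
  (lebesgue_outer [set x | A (x + v)%R] <= lebesgue_outer A)%E.
Proof.
apply: ereal_inf_le_tmp => _ [p Ap <-].
exists (fun k => ((p k).1 - v, (p k).2 - v)).
  move=> x /Ap[k _ kx]; exists k => // i; have := kx i; rewrite !mxE /=.
  by rewrite ltrBlDr lerBrDr.
apply: eq_eseriesr => k _; congr (_%:E); apply: eq_bigr => i _.
by rewrite !mxE /= opprB addrA subrK.
Qed.

Lemma outer_null_bigcup (I : countType) (F : I -> set V) :
  (forall i, lebesgue_outer (F i) = 0%E) -> lebesgue_outer (\bigcup_i F i) = 0%E.
Proof.
move=> F0; pose G k := if unpickle k is Some i then F i else set0.
have -> : \bigcup_i F i = \bigcup_k G k.
  apply/seteqP; split => [x [i _ Fx]|x [k _]].
    by exists (pickle i) => //; rewrite /G pickleK.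
  by rewrite /G; case: unpickle => // i Fx; exists i.
apply/eqP; rewrite eq_le outer_measure_ge0 andbT.
apply: le_trans (outer_measure_sigma_subadditive _ _) _.
rewrite eseries0// => k _ _; rewrite /G; case: unpickle => [i|]; first exact: F0.
exact: outer_measure0.
Qed.

(** An outer null set is Caratheodory measurable. *)
Lemma outer_null_ae A : lebesgue_outer A = 0%E -> \forall x \ae mes, ~ A x.
Proof.
move=> A0; exists A; split => //; last by move=> x /= /contrapT.
apply: le_caratheodory_measurable => X.
rewrite [X in (X + _)%E](_ : _ = 0%E); last first.
  apply/eqP; rewrite eq_le outer_measure_ge0 andbT -[leRHS]A0.
  by apply: le_outer_measure; exact: subIsetr.
by rewrite add0e; apply: le_outer_measure; exact: subIsetl.
Qed.

Lemma mes_ae_imply (P Q : V -> Prop) : (forall x, P x -> Q x) ->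
  (\forall x \ae mes, P x) -> \forall x \ae mes, Q x.
Proof. by move=> PQ; apply: negligibleS; exact: subsetC. Qed.

(** A half-space cuts every box into two boxes whose volumes add up. *)
Lemma measurable_halfspace i (c : R) :
  measurable ([set x | x 0 i <= c] : set (leb_space R n)).
Proof.
apply: le_caratheodory_measurable => X; apply: le_ereal_inf_tmp => _ [p Xp <-].
pose lo k : V * V := ((p k).1,
  \row_j (if j == i then Num.min ((p k).2 0 j) c else (p k).2 0 j)).
pose hi k : V * V := (\row_j (if j == i then Num.max ((p k).1 0 j) c
  else (p k).1 0 j), (p k).2).
have vol k : (box_volume (p k))%:E =
    ((box_volume (lo k))%:E + (box_volume (hi k))%:E)%E.
  rewrite -EFinD /box_volume [in RHS](bigD1 i)//= [in X in _ + X](bigD1 i)//=.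
  rewrite (bigD1 i)//= !mxE eqxx.
  rewrite [X in _ * X + _](eq_bigr (fun j => Num.max 0 ((p k).2 0 j - (p k).1 0 j))).
    rewrite [X in _ + _ * X](eq_bigr (fun j => Num.max 0 ((p k).2 0 j - (p k).1 0 j))).
      rewrite -mulrDl; congr (_ * _)%:E; rewrite !maxEle !minEle.
      repeat case: ifPn; rewrite -?ltNge; lra.
    by move=> j /negPf ji; rewrite mxE ji.
  by move=> j /negPf ji; rewrite mxE ji.
rewrite (eq_eseriesr (fun k _ => vol k)) nneseriesD; last 2 first.
- by move=> *; rewrite lee_fin box_volume_ge0.
- by move=> *; rewrite lee_fin box_volume_ge0.
apply: leeD; apply: ereal_inf_lbound.
  exists lo => // x [/Xp[k _ kx] /= xc]; exists k => // j; rewrite /= mxE.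
  case: eqP (kx j) => [->|_] // /andP[-> xk]; rewrite le_min xk xc //.
exists hi => // x [/Xp[k _ kx] /= /negP]; rewrite -ltNge => xc; exists k => // j.
rewrite /= mxE; case: eqP (kx j) => [->|_] // /andP[kx1 ->].
by rewrite gt_max kx1 xc.
Qed.

Lemma measurable_box a b : measurable (box (a, b) : set (leb_space R n)).
Proof.
have -> : box (a, b) =
    ~` \bigcup_i ([set x | x 0 i <= a 0 i] `|` ~` [set x | x 0 i <= b 0 i]).
  apply/seteqP; split => [x abx [i _ [/=|/=]]|x H i].
  - by have /andP[+ _] := abx i; rewrite ltNge => /negP.
  - by have /andP[_ +] := abx i.
  - rewrite ltNge; apply/andP; split; last apply/negPn; apply/negP => h.
      by apply: H; exists i => //; left.
    by apply: H; exists i => //; right; apply/negP.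
apply: measurableC; apply: (@countable_bigcupT_measurable _ (leb_space R n)).
  exact: countableP.
move=> i; apply: measurableU; first exact: measurable_halfspace.
by apply: measurableC; exact: measurable_halfspace.
Qed.

Lemma open_lebesgue_measurable U : open U -> lebesgue_measurable U.
Proof.
move=> oU; rewrite /lebesgue_measurable.
pose Q (q : 'rV[rat]_n.+1 * 'rV[rat]_n.+1) :=
  box (map_mx ratr q.1 : V, map_mx ratr q.2 : V).
have -> : U = \bigcup_q (if `[< Q q `<=` U >] then Q q else set0).
  apply/seteqP; split => [x Ux|x [q _]]; last by case: asboolP => // qU /qU.
  have /nbhs_box[e e0 eU] := open_nbhs_nbhs (conj oU Ux).
  have /choice[a aP] (i : 'I_n.+1) : exists q : rat, x 0 i - e < ratr q < x 0 i.
    by have [|q] := @rat_in_itvoo R (x 0 i - e) (x 0 i); [lra|rewrite in_itv; exists q].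
  have /choice[b bP] (i : 'I_n.+1) : exists q : rat, x 0 i < ratr q < x 0 i + e.
    by have [|q] := @rat_in_itvoo R (x 0 i) (x 0 i + e); [lra|rewrite in_itv; exists q].
  exists (\row_i a i, \row_i b i) => //; rewrite asboolT.
    by move=> i; rewrite !mxE; have := aP i; have := bP i; lra.
  move=> y yab; apply: eU => i; have := yab i; rewrite !mxE ltr_norml.
  by have := aP i; have := bP i; lra.
apply: (@countable_bigcupT_measurable _ (leb_space R n)) => [|q].
  exact: countableP.
case: ifP => _; last exact: measurable0; exact: measurable_box.
Qed.

(** The preimage of an open ray differs from its interior only by points of
    discontinuity, that is by a null set. *)
Lemma ae_continuous_measurable (g : V -> R) :
  (\forall x \ae mes, {for (x : V), continuous g}) ->
  measurable_fun [set: leb_space R n] (g : leb_space R n -> R).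
Proof.
move=> gc; apply: (measurability _ (RGenOInfty.measurableE R)) => //.
move=> _ [_ [a ->] <-]; rewrite setTI.
set A := g @^-1` _; pose I : set V := (A : set V)°.
have -> : A = I `|` (A `\` I).
  by rewrite setDUK//; exact: interior_subset.
apply: measurableU; first exact/open_lebesgue_measurable/open_interior.
apply: measure_is_complete_caratheodory; apply: negligibleS gc => x [Ax nIx] /= gx.
apply: nIx; apply: gx; apply: open_nbhs_nbhs; split; last by [].
exact: interval_open.
Qed.

End lebesgue_outer_theory.

(** * The periodized indicator function *)

Section periodized_indicator.
Context {R : realType} {n : nat}.
Local Notation V := 'rV[R]_n.+1.
Implicit Types (S : set V) (x y : V).

Lemma ler_coord_norm x i : `|x 0 i| <= `|x|.
Proof.
rewrite [leRHS]mx_normrE.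
exact: (le_bigmax _ (fun ij => `|x ij.1 ij.2|) (0, i)).
Qed.

Lemma of_intvecD (k l : 'rV[int]_n.+1) :
  of_intvec (k + l) = of_intvec k + of_intvec l :> V.
Proof. by apply/matrixP => i j; rewrite !mxE intrD. Qed.

Lemma of_intvecN (k : 'rV[int]_n.+1) : of_intvec (- k) = - of_intvec k :> V.
Proof. by apply/matrixP => i j; rewrite !mxE rmorphN. Qed.

Lemma chi_torus S : torus_function (chi S).
Proof.
move=> p x; rewrite /chi [RHS](reindex_fsbigT (fun k => p + k)).
  by apply: eq_fsbigr => k _; rewrite of_intvecD addrA.
by exists (fun k => - p + k) => k; rewrite addrA ?addNr ?subrr add0r.
Qed.

Lemma near_translate x v (P : V -> Prop) :
  (\forall z \near x + v, P z) -> \forall y \near x, P (y + v).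
Proof.
move=> /nbhs_box[e e0 eP].
have : nbhs x (ball x e) by exact: nbhsx_ballx.
apply: filterS => y [_ xy]; apply: eP => i.
by rewrite !mxE opprD addrACA subrr addr0 distrC; exact: xy.
Qed.

Lemma off_boundary_near S x : ~ boundary S x -> \forall y \near x, S y <-> S x.
Proof.
move=> nb; have [ix|nix] := pselect (S° x).
  by apply: filterS (ix) => y Sy; split=> // _; exact: interior_subset ix.
have : ~ closure S x by move=> cx; apply: nb.
move=> /existsNP[B /not_implyP[xB /set0P/negP/negPn/eqP SB0]].
have nB z : B z -> ~ S z by move=> Bz Sz; have : set0 z by rewrite -SB0.
have nSx : ~ S x := nB _ (nbhs_singleton xB).
by apply: filterS xB => y /nB.
Qed.

(** The series defining chi S has infinitely many terms, but S being
    bounded, only finitely many of them can be nonzero near x, and each is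
    locally constant off the boundary. *)
Lemma chi_locally_constant S x : bounded_set S ->
  (forall k, ~ boundary S (x + of_intvec k)) ->
  \forall y \near x, chi S y = chi S x.
Proof.
move=> [B [_ SB]] nb.
have {}SB y i : S y -> `|y 0 i| <= B + 1.
  by move=> Sy; rewrite (le_trans (ler_coord_norm y i))// SB// ltrDl.
pose M := Num.bound (`|B| + 2 + `|x|).
have MP : `|B| + 2 + `|x| < M%:R.
  by apply: archi_boundP; rewrite !addr_ge0.
(* The vectors kap f are the integer vectors with entries in [-M, M]. *)
pose kap (f : {ffun 'I_n.+1 -> 'I_(M + M).+1}) : 'rV[int]_n.+1 :=
  \row_i ((f i : nat)%:Z - M%:Z).
have kapP y k : (forall i, `|y 0 i - x 0 i| < 1) -> S (y + of_intvec k) ->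
    exists f, k = kap f.
  move=> xy Syk.
  have kM i : `|k 0 i| <= M%:Z.
    rewrite -(ler_int R) intr_norm; have := SB _ i Syk; rewrite !mxE => h.
    have := ler_coord_norm x i; have := xy i; have := ler_norm B.
    move: h; rewrite !ler_norml !ltr_norml => /andP[h1 h2] h3 /andP[h4 h5] /andP[h6 h7].
    apply/andP; split; move: MP; rewrite -[M%:~R]/(M%:R); lra.
  exists [ffun i => inord (absz (k 0 i + M%:Z))].
  apply/matrixP => i j; rewrite ord1 !mxE ffunE.
  have := kM j; rewrite ler_norml => /andP[k1 k2].
  rewrite inordK.
    by rewrite gez0_abs ?addrK// -lerBlDr sub0r.
  by rewrite ltnS -lez_nat gez0_abs ?PoszD ?lerD2r// -lerBlDr sub0r.
have nearf : \forall y \near x, forall f,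
    S (y + of_intvec (kap f)) <-> S (x + of_intvec (kap f)).
  apply: (@filter_forall _ _ (fun f y =>
    S (y + of_intvec (kap f)) <-> S (x + of_intvec (kap f))) (nbhs x)) => f.
  have := off_boundary_near (nb (kap f)).
  exact: near_translate.
have near1 : \forall y \near x, forall i, `|(y : V) 0 i - x 0 i| < 1.
  have : nbhs x (ball x 1) by exact: nbhsx_ballx.
  apply: filterS => y [_ xy] i; rewrite distrC; exact: xy.
near=> y; apply: eq_fsbigr => k _; rewrite !indicE.
have y1 : forall i, `|y 0 i - x 0 i| < 1 by near: y.
have yf : forall f, S (y + of_intvec (kap f)) <-> S (x + of_intvec (kap f)) by near: y.
suff -> : (y + of_intvec k \in S) = (x + of_intvec k \in S) by [].
apply/idP/idP; rewrite !inE => Sk.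
  by have [f kE] := kapP _ _ y1 Sk; rewrite kE -yf -kE.
have [|f kE] := kapP _ _ _ Sk; first by move=> i; rewrite subrr normr0.
by rewrite kE yf -kE.
Unshelve. all: by end_near. Qed.

End periodized_indicator.

(** * The cohomological equation on a dense invariant set *)

Section gottschalk_hedlund.
Context {R : realType} {n : nat}.
Local Notation V := 'rV[R]_n.+1.
Variables (alpha : V) (f : V -> R) (G : set V) (C : R).
Hypothesis irr : irrational_vector alpha.
Hypothesis f_torus : torus_function f.
Hypothesis G_torus : forall x p, G x -> G (x + of_intvec p).
Hypothesis G_addr : forall x, G x -> G (x + alpha).
Hypothesis G_subr : forall x, G x -> G (x - alpha).
Hypothesis G_dense : forall (x : V) (U : set V), nbhs x U -> exists2 y, U y & G y.
Hypothesis f_cont : forall x, G x -> {for x, continuous f}.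
Hypothesis f_bound : forall x m, G x -> `|\sum_(k < m) f (x + alpha *+ k)| <= C.
Implicit Types (x y : V) (U : set V) (e : R) (z : int) (p : 'rV[int]_n.+1).

(** The sums of f along the orbit of x, extended to negative times so that
    cocycle (z + z') x = cocycle z x + cocycle z' (x + alpha *~ z). *)
Definition cocycle z x : R :=
  match z with
  | Posz m => \sum_(k < m) f (x + alpha *+ k.+1)
  | Negz m => - \sum_(k < m.+1) f (x - alpha *+ k)
  end.

Lemma cocycle_step z x : cocycle z (x - alpha) = f x + cocycle (z - 1) x.
Proof.
case: z => [[|m]|m].
- by rewrite /= big_ord0 big_ord1 mulr0n subr0 subrr.
- have -> : m.+1%:Z - 1 = m%:Z by rewrite -addn1 PoszD addrK.
  rewrite /= big_ord_recl /= mulr1n subrK; congr (_ + _).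
  by apply: eq_bigr => k _; rewrite /bump /= add1n mulrS addrA subrK.
- have -> : Negz m - 1 = Negz m.+1 by rewrite !NegzE -opprD -PoszD addn1.
  rewrite /= [in RHS]big_ord_recl /= mulr0n subr0 opprD addrA subrr add0r.
  by congr (- _); apply: eq_bigr => k _; rewrite /bump /= add1n mulrS opprD addrA.
Qed.

Lemma cocycle_torus z p x : cocycle z (x + of_intvec p) = cocycle z x.
Proof.
case: z => m /=; first by apply: eq_bigr => k _; rewrite addrAC f_torus.
by congr (- _); apply: eq_bigr => k _; rewrite addrAC f_torus.
Qed.

Lemma G_addrn x k : G x -> G (x + alpha *+ k).
Proof.
move=> Gx; elim: k => [|k IH]; first by rewrite mulr0n addr0.
by rewrite mulrSr addrA; exact: G_addr.
Qed.

Lemma G_subrn x k : G x -> G (x - alpha *+ k).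
Proof.
move=> Gx; elim: k => [|k IH]; first by rewrite mulr0n subr0.
by rewrite mulrSr opprD addrA; exact: G_subr.
Qed.

Lemma cocycle_bound z x : G x -> `|cocycle z x| <= C.
Proof.
case: z => m Gx /=.
  under eq_bigr do rewrite mulrS addrA.
  exact/f_bound/G_addr.
rewrite normrN; have := @f_bound (x - alpha *+ m) m.+1 (G_subrn _ Gx).
rewrite (reindex_inj rev_ord_inj) /=; congr (`|_| <= _).
apply: eq_bigr => k _; rewrite subSS mulrnBr; last by rewrite -ltnS.
by rewrite addrA subrK.
Qed.

Lemma cocycle_near z x e : G x -> 0 < e ->
  \forall y \near x, `|cocycle z y - cocycle z x| < e.
Proof.
move=> Gx e0.
have sum_near m (v : nat -> V) : (forall k, G (x + v k)) -> forall e, 0 < e ->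
    \forall y \near x, `|\sum_(k < m) f (y + v k) - \sum_(k < m) f (x + v k)| < e.
  move=> Gv; elim: m => [|m IH] d d0.
    by near=> y; rewrite !big_ord0 subrr normr0.
  have h1 := IH (d / 2) (divr_gt0 d0 (ltr0Sn _ _)).
  have h2 : \forall y \near x, `|f (y + v m) - f (x + v m)| < d / 2.
    apply: (near_translate (P := fun y => `|f y - f (x + v m)| < d / 2)).
    have /cvgrPdist_lt/(_ (d / 2)) := f_cont (Gv m).
    rewrite divr_gt0// => /(_ isT).
    by apply: filterS => y; rewrite distrC.
  near=> y; rewrite !big_ord_recr /= opprD addrACA.
  rewrite (le_lt_trans (ler_normD _ _))// [ltRHS](splitr d) ltrD//; by near: y.
case: z => m /=.
  by apply: (sum_near m (fun k => alpha *+ k.+1)) => // k; exact: G_addrn.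
have := sum_near m.+1 (fun k => - (alpha *+ k)) (fun k => G_subrn k Gx) e e0.
by apply: filterS => y; rewrite -opprD normrN.
Unshelve. all: by end_near. Qed.

(** Both extrema over all integer times solve the cohomological equation up
    to sign, by reindexing the orbit. *)
Definition cocycle_sup x : R := sup [set cocycle z x | z in setT].
Definition cocycle_inf x : R := inf [set cocycle z x | z in setT].

Let has_sup_cocycle x : G x -> has_sup [set cocycle z x | z in setT].
Proof.
move=> Gx; split; first by exists (cocycle 0 x), 0.
by exists C => _ [z _ <-]; rewrite (le_trans (ler_norm _))// cocycle_bound.
Qed.

Let has_inf_cocycle x : G x -> has_inf [set cocycle z x | z in setT].
Proof.
move=> Gx; split; first by exists (cocycle 0 x), 0.
exists (- C) => _ [z _ <-].
by have := cocycle_bound z Gx; rewrite ler_norml => /andP[].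
Qed.

Lemma le_cocycle_sup z x : G x -> cocycle z x <= cocycle_sup x.
Proof. by move=> Gx; apply: ub_le_sup; [case: (has_sup_cocycle Gx)|exists z]. Qed.

Lemma cocycle_inf_le z x : G x -> cocycle_inf x <= cocycle z x.
Proof. by move=> Gx; apply: ge_inf; [case: (has_inf_cocycle Gx)|exists z]. Qed.

Lemma cocycle_sup_le x c : (forall z, cocycle z x <= c) -> cocycle_sup x <= c.
Proof.
move=> xc; apply: ge_sup; first by exists (cocycle 0 x), 0.
by move=> _ [z _ <-].
Qed.

Lemma le_cocycle_inf x c : (forall z, c <= cocycle z x) -> c <= cocycle_inf x.
Proof.
move=> xc; apply: lb_le_inf; first by exists (cocycle 0 x), 0.
by move=> _ [z _ <-].
Qed.

Lemma cocycle_sup_step x : G x -> cocycle_sup (x - alpha) = f x + cocycle_sup x.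
Proof.
move=> Gx; apply/eqP; rewrite eq_le; apply/andP; split.
  by apply: cocycle_sup_le => z; rewrite cocycle_step lerD2l le_cocycle_sup.
rewrite -lerBrDl; apply: cocycle_sup_le => z; rewrite lerBrDl.
have -> : z = z + 1 - 1 by rewrite addrK.
by rewrite -cocycle_step le_cocycle_sup//; exact: G_subr.
Qed.

Lemma cocycle_inf_step x : G x -> cocycle_inf (x - alpha) = f x + cocycle_inf x.
Proof.
move=> Gx; apply/eqP; rewrite eq_le; apply/andP; split.
  rewrite -lerBlDl; apply: le_cocycle_inf => z; rewrite lerBlDl.
  have -> : z = z + 1 - 1 by rewrite addrK.
  by rewrite -cocycle_step cocycle_inf_le//; exact: G_subr.
by apply: le_cocycle_inf => z; rewrite cocycle_step lerD2l cocycle_inf_le.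
Qed.

Lemma cocycle_sup_torus : torus_function cocycle_sup.
Proof.
move=> p x; congr (sup _); apply: eq_imagel => z _; exact: cocycle_torus.
Qed.

Lemma cocycle_inf_torus : torus_function cocycle_inf.
Proof.
move=> p x; congr (inf _); apply: eq_imagel => z _; exact: cocycle_torus.
Qed.

Lemma cocycle_sup_lsc x e : G x -> 0 < e ->
  \forall y \near x, G y -> cocycle_sup x - e < cocycle_sup y.
Proof.
move=> Gx e0; have e2 : 0 < e / 2 by rewrite divr_gt0.
have [_ [z _ <-] tz] := sup_adherent e2 (has_sup_cocycle Gx).
have := cocycle_near z Gx e2; apply: filterS => y zy Gy.
have := le_cocycle_sup z Gy; move: zy; rewrite ltr_norml => /andP[].
move: tz; rewrite -/(cocycle_sup x); lra.
Qed.

Lemma cocycle_inf_usc x e : G x -> 0 < e ->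
  \forall y \near x, G y -> cocycle_inf y < cocycle_inf x + e.
Proof.
move=> Gx e0; have e2 : 0 < e / 2 by rewrite divr_gt0.
have [_ [z _ <-] tz] := inf_adherent e2 (has_inf_cocycle Gx).
have := cocycle_near z Gx e2; apply: filterS => y zy Gy.
have := cocycle_inf_le z Gy; move: zy; rewrite ltr_norml => /andP[].
move: tz; rewrite -/(cocycle_inf x); lra.
Qed.

(** The difference of two solutions of the same cohomological equation,
    hence constant along each orbit. *)
Definition cocycle_osc x := cocycle_sup x - cocycle_inf x.

Lemma cocycle_osc_orbit x k p : G x ->
  cocycle_osc (x + alpha *+ k + of_intvec p) = cocycle_osc x.
Proof.
move=> Gx; rewrite /cocycle_osc cocycle_sup_torus cocycle_inf_torus.
elim: k => [|k <-]; first by rewrite mulr0n addr0.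
have := cocycle_sup_step (G_addrn k.+1 Gx); have := cocycle_inf_step (G_addrn k.+1 Gx).
rewrite mulrSr addrA addrK => -> ->; ring.
Qed.

(** The oscillation is lower semicontinuous at x relatively to G, and the
    orbit of y comes arbitrarily close to x by Kronecker's theorem.
    Exchanging x and y shows that the oscillation is constant on G. *)
Lemma cocycle_osc_le x y : G x -> G y -> cocycle_osc x <= cocycle_osc y.
Proof.
move=> Gx Gy; apply/ler_addgt0Pr => e e0.
have e2 : 0 < e / 2 by rewrite divr_gt0.
have U : \forall t \near x, G t -> cocycle_osc x < cocycle_osc t + e.
  have := cocycle_sup_lsc Gx e2; have := cocycle_inf_usc Gx e2.
  apply: filterS2 => t b a Gt; have := b Gt; have := a Gt; rewrite /cocycle_osc; lra.
have [d d0 dU] := nbhs_box U.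
have [k [p kp]] := kronecker irr (x - y) d0.
have Gt : G (y + alpha *+ k + of_intvec (- p)) by exact/G_torus/G_addrn.
rewrite -(cocycle_osc_orbit k (- p) Gy); apply/ltW/dU => // i.
have := kp i; congr (`|_| < _).
by rewrite of_intvecN !mxE mulmxnE -mulr_natl; ring.
Qed.

(** The supremum equals the infimum plus a constant on G, so it is upper as
    well as lower semicontinuous there. *)
Lemma cocycle_sup_near x e : G x -> 0 < e ->
  \forall y \near x, G y -> `|cocycle_sup y - cocycle_sup x| < e.
Proof.
move=> Gx e0; have := cocycle_sup_lsc Gx e0; have := cocycle_inf_usc Gx e0.
apply: filterS2 => y b a Gy; have := b Gy; have := a Gy.
have := cocycle_osc_le Gx Gy; have := cocycle_osc_le Gy Gx.
rewrite /cocycle_osc ltr_norml; lra.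
Qed.

Let sup_germ x := cocycle_sup @ within G (nbhs x).

(** Any choice of a limit value along G at each point extends the supremum
    to a function continuous at the points of G. The choice only depends on
    the set of limit values, and is therefore periodic. *)
Definition sup_ext x := xget 0 (cluster (sup_germ x)).

Lemma sup_ext_approx x U e : nbhs x U -> 0 < e ->
  exists y, [/\ U y, G y & `|cocycle_sup y - sup_ext x| < e].
Proof.
move=> xU e0.
have PF : ProperFilter (sup_germ x).
  apply: fmap_proper_filter; apply: Build_ProperFilter_ex => A xA.
  by have [y yA Gy] := G_dense xA; exists y; exact: yA.
have [r [_ rc]] : `[- C, C] `&` cluster (sup_germ x) !=set0.
  apply: (@segment_compact _ (- C) C (sup_germ x) PF).
  apply: (@filterE _ (nbhs x)) => y Gy.
  rewrite /= in_itv /=; apply/andP; split.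
    have := le_cocycle_sup 0 Gy; apply: le_trans.
    by have := cocycle_bound 0 Gy; rewrite ler_norml => /andP[].
  by apply: cocycle_sup_le => z; rewrite (le_trans (ler_norm _))// cocycle_bound.
have {rc} : cluster (sup_germ x) (sup_ext x) by apply: (xgetI 0 rc).
move=> /(_ (cocycle_sup @` (U `&` G)) (ball (sup_ext x) e)) [].
- rewrite /sup_germ /fmap /= /within /=; apply: filterS xU => y Uy Gy.
  by exists y.
- exact: nbhsx_ballx.
- move=> _ [[y [Uy Gy] <-]]; rewrite /ball /= distrC => h; exists y; split => //.
Qed.

Lemma sup_extE x : G x -> sup_ext x = cocycle_sup x.
Proof.
move=> Gx; apply/eqP; rewrite -subr_eq0 -normr_le0.
apply/ler_addgt0Pr => e e0; rewrite add0r; have e2 : 0 < e / 2 by rewrite divr_gt0.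
have [y [h Gy]] := sup_ext_approx (cocycle_sup_near Gx e2) e2; have {}h := h Gy.
move: h; rewrite ler_norml !ltr_norml; lra.
Qed.

Lemma sup_ext_cont x : G x -> {for x, continuous sup_ext}.
Proof.
move=> Gx; apply/(@cvgrPdist_lt _ _ _ (nbhs x) (nbhs_filter x)) => e e0.
have e2 : 0 < e / 2 by rewrite divr_gt0.
have /nbhs_interior := cocycle_sup_near Gx e2.
apply: filterS => y yU; have [t [h Gt]] := sup_ext_approx yU e2.
have {}h := h Gt; rewrite (sup_extE Gx); move: h; rewrite !ltr_norml; lra.
Qed.

Lemma sup_ext_bound x : `|sup_ext x| <= C + 1.
Proof.
have [y [_ Gy]] := @sup_ext_approx x setT 1 filterT ltr01.
have : cocycle_sup y <= C.
  by apply: cocycle_sup_le => z; rewrite (le_trans (ler_norm _))// cocycle_bound.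
have : - C <= cocycle_sup y.
  apply: le_trans (le_cocycle_sup 0 Gy).
  by have := cocycle_bound 0 Gy; rewrite ler_norml => /andP[].
rewrite ler_norml ltr_norml; lra.
Qed.

Lemma sup_ext_torus : torus_function sup_ext.
Proof.
move=> p x; rewrite /sup_ext; congr (xget 0 (cluster _)).
have sub q y A : sup_germ y A -> sup_germ (y + of_intvec q) A.
  rewrite /sup_germ /fmap /= /within /= => H.
  have : \forall t \near y + of_intvec q,
      G (t - of_intvec q) -> A (cocycle_sup (t - of_intvec q)).
    by apply: (near_translate (P := fun t => G t -> A (cocycle_sup t))); rewrite addrK.
  apply: filterS => t; rewrite -of_intvecN cocycle_sup_torus => h Gt; apply: h.
  exact: G_torus.
apply/seteqP; split => A; last exact: sub.
by move=> /(sub (- p)); rewrite of_intvecN addrK.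
Qed.

(** The Gottschalk-Hedlund theorem for irrational rotations of the torus,
    with continuity and bounded sums only required on a dense invariant set.
    The sign comes from the cocycle, which satisfies cocycle z (x - alpha) -
    cocycle (z - 1) x = f x. *)
Theorem continuous_coboundary_on : exists g : V -> R,
  [/\ torus_function g, bounded_fun g,
      forall x, G x -> {for x, continuous g} &
      forall x, G x -> g x - g (x - alpha) = f x].
Proof.
exists (fun x => - sup_ext x); split.
- by move=> p x; rewrite sup_ext_torus.
- exists (C + 1); split; [exact: num_real|move=> M CM x _].
  by rewrite /= normrN (le_trans (sup_ext_bound x))// ltW.
- by move=> x Gx; exact: (continuousN (sup_ext_cont Gx)).
- move=> x Gx; rewrite !sup_extE//; last exact: G_subr.
  rewrite cocycle_sup_step//; ring.
Qed.

End gottschalk_hedlund.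

(** * Transfer functions of Riemann measurable bounded remainder sets *)

Section good_points.
Context {R : realType} {n : nat}.
Local Notation V := 'rV[R]_n.+1.
Variables (alpha : V) (S : set V).

Definition off_boundary_orbit : set V :=
  [set x | forall (z : int) (p : 'rV[int]_n.+1),
    ~ boundary S (x + (alpha *~ z + of_intvec p))].
Local Notation G := off_boundary_orbit.

Lemma off_boundary_orbit_ae : riemann_measurable S -> \forall x \ae mes, G x.
Proof.
move=> [_ bS0].
pose F (zp : int * 'rV[int]_n.+1) : set V :=
  [set x | boundary S (x + (alpha *~ zp.1 + of_intvec zp.2))].
have : lebesgue_outer (\bigcup_zp F zp) = 0%E.
  apply: outer_null_bigcup => zp; apply/eqP; rewrite eq_le outer_measure_ge0 andbT.
  by rewrite -bS0; exact: le_lebesgue_outer_shift.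
move=> /outer_null_ae; apply: mes_ae_imply => x nFx z p bx; apply: nFx.
by exists (z, p).
Qed.

Lemma off_boundary_orbitD x z p : G x -> G (x + (alpha *~ z + of_intvec p)).
Proof.
move=> Gx z' p'; rewrite -addrA [X in x + X]addrACA -mulrzDr -of_intvecD.
exact: Gx.
Qed.

(** At such points the sums are locally constant, so a bound that holds
    almost everywhere, hence on a dense set, holds at each of them. *)
Lemma off_boundary_orbit_sum_bound : riemann_measurable S ->
  bounded_remainder_set alpha S ->
  exists C, forall x m, G x ->
    `|\sum_(k < m) (chi S (x + alpha *+ k) - fine (mes S))| <= C.
Proof.
move=> rS [bS _ [C HC]]; exists (Num.max 0 C) => x m Gx.
rewrite le_max; case: m => [|m]; first by rewrite big_ord0 normr0 lexx.
apply/orP; right.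
have loc : \forall y \near x, forall k : 'I_m.+1,
    chi S (y + alpha *+ k) = chi S (x + alpha *+ k).
  apply: (@filter_forall _ _ (fun (k : 'I_m.+1) y =>
    chi S (y + alpha *+ k) = chi S (x + alpha *+ k)) (nbhs x)) => k.
  apply: (near_translate (P := fun y => chi S y = chi S (x + alpha *+ k))).
  apply: chi_locally_constant => // p; rewrite -addrA pmulrn; exact: Gx.
have [y yx] := ae_dense (HC m.+1 isT) loc.
congr (`|_| <= _); rewrite big_mkord sumrB sumr_const card_ord mulr_natl.
by congr (_ - _); apply: eq_bigr => k _; rewrite yx.
Qed.

End good_points.

Theorem theorem6 (R : realType) (n : nat) (alpha : 'rV[R]_n.+1)
    (S : set 'rV[R]_n.+1) :
  irrational_vector alpha ->
  riemann_measurable S ->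
  bounded_remainder_set alpha S ->
  exists g : 'rV[R]_n.+1 -> R,
    transfer_function alpha S g /\ riemann_integrable_torus g.
Proof.
move=> irr rS brs; have bS : bounded_set S by case: rS.
pose G := off_boundary_orbit alpha S.
have Gae : \forall x \ae mes, G x by exact: off_boundary_orbit_ae.
have GD x z p : G x -> G (x + (alpha *~ z + of_intvec p)).
  exact: off_boundary_orbitD.
have oi0 : of_intvec 0 = 0 :> 'rV[R]_n.+1 by apply/matrixP => i j; rewrite !mxE.
have [C HC] := off_boundary_orbit_sum_bound rS brs.
have G_torus x p : G x -> G (x + of_intvec p).
  by move=> /(GD x 0 p); rewrite mulr0z add0r.
have G_addr x : G x -> G (x + alpha).
  by move=> /(GD x 1 0); rewrite mulr1z oi0 addr0.
have G_subr x : G x -> G (x - alpha).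
  by move=> /(GD x (-1) 0); rewrite mulrN1z oi0 addr0.
have G_dense (x : 'rV[R]_n.+1) (U : set 'rV[R]_n.+1) :
    nbhs x U -> exists2 y, U y & G y.
  exact: (ae_dense Gae).
have f_torus : torus_function (fun x => chi S x - fine (mes S)).
  by move=> p x; rewrite chi_torus.
have f_cont x : G x -> {for x, continuous (fun x => chi S x - fine (mes S))}.
  move=> Gx U xU.
  apply: (@filterS _ (nbhs x) (nbhs_filter x) [set y | chi S y = chi S x]).
    by move=> y /= ->; exact: nbhs_singleton.
  apply: chi_locally_constant => // p.
  by have := Gx 0 p; rewrite mulr0z add0r.
have [g [gt gb gc gE]] := continuous_coboundary_on irr f_torus G_torus G_addr
  G_subr G_dense f_cont HC.
have gcae : \forall x \ae mes, {for (x : 'rV[R]_n.+1), continuous g}.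
  exact: mes_ae_imply gc Gae.
exists g; split; split => //; first exact: ae_continuous_measurable.
by apply: mes_ae_imply Gae => x /gE.
Qed.
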